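(* Let $n\ge 2$ and let $S$ be a set of $n$ points in $\mathbb{R}^2$, no three of which lie on a line. Then the number of unordered pairs $\{p,q\}\subset S$ such that $|p-q|\in\mathbb{Q}$ and $\{p,q\}$ has rational angle is at most $n^{1+6/\sqrt{\log n}}$, where $\log$ denotes the natural logarithm.
   Context: Identify $\mathbb{R}^2$ with $\mathbb{C}$. A pair of distinct points $p,q$ has rational angle if the segment between them, viewed as the complex number $q-p=re^{\pi i\gamma}$ with $r>0$, has $\gamma\in\mathbb{Q}$; equivalently, the line through $p$ and $q$ makes an angle with the $x$-axis that is a rational multiple of $\pi$. *)

(* Defs.v *)
From Stdlib Require Import Reals Lra ZArith List Classical ClassicalDescription.
Open Scope R_scope.

Definition point := (R * R)%type.

Definition Rrational (x : R) : Prop :=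
  exists a b : Z, b <> 0%Z /\ x = IZR a / IZR b.

Definition dist2 (p q : point) : R :=
  sqrt ((fst q - fst p) ^ 2 + (snd q - snd p) ^ 2).

Definition rational_angle (p q : point) : Prop :=
  p <> q /\
  exists r g : R, 0 < r /\ Rrational g /\
    fst q - fst p = r * cos (PI * g) /\ snd q - snd p = r * sin (PI * g).

Definition good_pair (p q : point) : Prop :=
  Rrational (dist2 p q) /\ rational_angle p q.

Definition no_three_collinear (S : list point) : Prop :=
  forall a b c, In a S -> In b S -> In c S -> a <> b -> b <> c -> a <> c ->
    (fst b - fst a) * (snd c - snd a) - (snd b - snd a) * (fst c - fst a) <> 0.

Definition indic (P : Prop) : nat :=
  if excluded_middle_informative P then 1%nat else 0%nat.

(* number of pairs (S_i, S_j), i < j, satisfying P; for S without duplicates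
   this is the number of unordered pairs {p,q} of S satisfying the symmetric P *)
Fixpoint count_pairs (P : point -> point -> Prop) (S : list point) : nat :=
  match S with
  | nil => 0%nat
  | p :: S' => (fold_right (fun q acc => (indic (P p q) + acc)%nat) 0%nat S'
                + count_pairs P S')%nat
  end.

(* Main.v *)
(* Identify the plane with C, so that good pairs differ by a rational multiple
   of a root of unity. If there are too many of them, deleting vertices of low
   degree leaves a graph on T with minimum degree > d, where d is about
   exp (6 sqrt (log n)). Walk in it k times, k about sqrt (log n), always
   avoiding steps that create a vanishing subsum of the step vectors: this
   excludes at most 2^k steps each time, so there are at least (d + 1 - 2^k)^k
   such walks, and some endpoint is reached by a 1/n fraction of them. Two such
   walks a, b with the same endpoints give the relation sum a_i - sum b_j = 0, and
   a minimal vanishing subsum through a given b_j has to contain some a_i. By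
   Mann's theorem b_j is then a rational multiple of w a_i for a root of unity w
   whose order divides the product of the primes up to 2k, hence is at most
   4^(2k). As no three points are collinear, each direction w a_i is followed by
   at most one point, so an endpoint is reached at most (k 4^(2k))^k times. *)
Require Import Defs.
From Stdlib Require Import Reals List.
From Stdlib Require Import Lra Lia ZArith.
Open Scope R_scope.

(** * Real estimates fixing the walk length and the degree threshold *)

Lemma nat_floor (x : R) : 0 <= x -> exists d : nat, INR d <= x < INR d + 1.
Proof.
intros x0; destruct (archimed x) as [H1 H2].
assert (up0 : (0 < up x)%Z) by (apply lt_IZR; lra).
exists (Z.to_nat (up x - 1)); rewrite INR_IZR_INZ, Z2Nat.id by lia.
rewrite minus_IZR; lra.
Qed.

Lemma exp_mul_nat (x : R) (k : nat) : exp (INR k * x) = exp x ^ k.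
Proof.
induction k as [|k IH]; [simpl; rewrite Rmult_0_l; apply exp_0|].
rewrite S_INR, Rmult_plus_distr_r, Rmult_1_l, exp_plus, IH; simpl; ring.
Qed.

Lemma le_pow2 (k : nat) : INR k <= 2 ^ k.
Proof.
induction k as [|k IH]; [simpl; lra|].
assert (1 <= 2 ^ k) by (apply pow_R1_Rle; lra).
rewrite S_INR; simpl; lra.
Qed.

Lemma Rexp_le (x y : R) : x <= y -> exp x <= exp y.
Proof. intros [H | ->]; [left; apply exp_increasing, H | right; reflexivity]. Qed.

Lemma pow2_le_exp (k : nat) : 2 ^ k <= exp (INR k).
Proof.
rewrite <- (Rmult_1_r (INR k)), exp_mul_nat; apply pow_incr.
pose proof (exp_ineq1_le 1); lra.
Qed.

Lemma pow32_le_exp (k : nat) : 32 ^ k <= exp (INR k * 4).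
Proof.
rewrite exp_mul_nat; apply pow_incr; split; [lra|].
(* The bound [1 + x <= exp x] is too weak at 4; taken at 1/4 and raised to the power 16 it gives
   (5/4)^16 > 32. *)
replace 4 with (INR 16 * / 4) by (simpl; field).
rewrite exp_mul_nat; apply Rle_trans with ((1 + / 4) ^ 16); [lra|].
apply pow_incr; pose proof (exp_ineq1_le (/ 4)); lra.
Qed.

Lemma pow_lt_compat_l (x y : R) (k : nat) : 0 <= x < y -> (0 < k)%nat -> x ^ k < y ^ k.
Proof.
intros xy; induction k as [|[|k] IH]; intros k0; [lia | simpl; lra |].
rewrite <- 2!tech_pow_Rmult with (n := S k).
apply Rmult_le_0_lt_compat; try lra; [apply pow_le; lra | apply IH; lia].
Qed.

(* With k the integer part of L, the left-hand side is at most exp (31 L k / 6). *)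
Lemma walk_count_parameters (L N : R) : 6 < L -> 0 <= N <= exp (L * L) ->
  exists k d : nat, INR d <= exp (6 * L) /\ 2 ^ k <= INR (S d) /\
    N * (INR k * 4 ^ (2 * k)) ^ k < (INR (S d) - 2 ^ k) ^ k.
Proof.
intros HL HN.
destruct (nat_floor L) as [k Hk]; [lra|].
destruct (nat_floor (exp (6 * L))) as [d Hd]; [left; apply exp_pos|].
exists k, d; split; [lra|].
assert (k6 : 6 <= INR k).
{ change 6 with (IZR (Z.of_nat 6)); rewrite <- INR_IZR_INZ; apply le_INR.
  assert (5 < k)%nat; [|lia]. apply INR_lt; simpl; lra. }
assert (kpos : (0 < k)%nat) by (apply INR_lt; simpl; lra).
assert (H16 : INR k * 4 ^ (2 * k) <= exp (4 * L)).
{ apply Rle_trans with (32 ^ k).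
  - rewrite pow_mult. replace 32 with (2 * 4 ^ 2) by ring.
    rewrite Rpow_mult_distr; apply Rmult_le_compat_r; [apply pow_le; lra | apply le_pow2].
  - apply Rle_trans with (exp (INR k * 4)); [apply pow32_le_exp | apply Rexp_le; lra]. }
(* From [6 <= k] and [L < k + 1] follows [L <= 7/6 * k], so [L * L] is at most [k * (7/6 * L)]. *)
assert (HNk : N <= exp (7 / 6 * L) ^ k).
{ rewrite <- exp_mul_nat; apply Rle_trans with (1 := proj2 HN), Rexp_le; nra. }
assert (H0 : 0 <= INR k * 4 ^ (2 * k)).
{ apply Rmult_le_pos; [lra | apply pow_le; lra]. }
(* [S d] exceeds [exp (6 * L)], which is more than 6 times [exp (31/6 * L)], and [2 ^ k] removes at
   most one of these 6. The exponent 31/6 is 7/6 + 4, from the bounds on [N] and on [k * 16 ^ k]. *)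
assert (Hd' : exp (31 / 6 * L) < INR (S d) - 2 ^ k).
{ rewrite S_INR.
  assert (exp (6 * L) = exp (31 / 6 * L) * exp (5 / 6 * L)).
  { rewrite <- exp_plus; f_equal; field. }
  pose proof (exp_ineq1_le (5 / 6 * L)).
  assert (2 ^ k <= exp (31 / 6 * L)).
  { apply Rle_trans with (1 := pow2_le_exp k), Rexp_le; lra. }
  pose proof (exp_pos (31 / 6 * L)); nra. }
split; [pose proof (exp_pos (31 / 6 * L)); lra|].
apply Rle_lt_trans with (exp (31 / 6 * L) ^ k).
- replace (31 / 6 * L) with (7 / 6 * L + 4 * L) by field.
  rewrite exp_plus, (Rpow_mult_distr (exp _) (exp _)).
  apply Rmult_le_compat; try assumption.
  + lra.
  + apply pow_le; assumption.
  + apply pow_incr; lra.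
- apply pow_lt_compat_l; [split; [left; apply exp_pos|]|]; assumption.
Qed.

(* The module keeps the MathComp notations away from the final statement. *)
Module RootsOfUnity.
From mathcomp Require Import all_boot all_order all_algebra.
From mathcomp Require Import cyclic separable cyclotomic algC complex.
From mathcomp Require Import boolp reals Rstruct.
Set Implicit Arguments. Unset Strict Implicit. Unset Printing Implicit Defensive.
Import Order.TTheory GRing.Theory Num.Theory.
Local Open Scope ring_scope.

(** * Vanishing sums of roots of unity *)

Lemma map_polyXn_sub1 (R1 R2 : nzRingType) (f : {rmorphism R1 -> R2}) n :
  map_poly f ('X^n - 1) = 'X^n - 1.
Proof. by rewrite rmorphB rmorph1 /= map_polyXn. Qed.

(** As a root of X^m - 1, [z] is a root of some Phi_d with d dividing m; then z^d = 1, which forces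
    d = m. *)
Lemma root_Cyclotomic (F : numFieldType) m (z : F) :
  m.-primitive_root z -> root (map_poly intr 'Phi_m) z.
Proof.
move=> prz; have m_gt0 := prim_order_gt0 prz.
have rootXn1 d : root (map_poly intr ('X^d - 1 : {poly int})) z = (z ^+ d == 1).
  by rewrite map_polyXn_sub1 rootE !hornerE subr_eq0.
have : root (map_poly intr ('X^m - 1 : {poly int})) z.
  by rewrite rootXn1 (prim_expr_order prz).
rewrite -prod_Cyclotomic // rmorph_prod rootE horner_prod prodf_seq_eq0.
case/hasP=> d; rewrite -dvdn_divisors //= => d_dv_m rd.
have [<- // | ltdm] := eqVneq d m.
have d_gt0 : (0 < d)%N := dvdn_gt0 m_gt0 d_dv_m.
suff : z ^+ d == 1.
  rewrite -(prim_order_dvd prz) => m_dv_d.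
  by case/negP: ltdm; rewrite eqn_dvd d_dv_m.
rewrite -rootXn1 -prod_Cyclotomic // (big_rem d) /=; last by rewrite -dvdn_divisors.
by rewrite rmorphM rootM /root rd.
Qed.

(** Phi_m is the minimal polynomial over the rationals of a primitive root in [algC], so
    divisibility by it means vanishing at that root. *)
Lemma Cyclotomic_irreducible m (g h : {poly rat}) : (0 < m)%N ->
  map_poly intr 'Phi_m = g * h ->
  (map_poly intr 'Phi_m %| g) || (map_poly intr 'Phi_m %| h).
Proof.
move=> m_gt0; have [z prz] := C_prim_root_exists m_gt0.
have [p [Dp _] dvp] := minCpolyP z.
have -> : map_poly intr 'Phi_m = p.
  apply: (map_inj_poly (fmorph_inj (@ratr algC))); first by rewrite rmorph0.
  rewrite -Dp (minCpoly_cyclotomic prz) -(Cintr_Cyclotomic prz) -map_poly_comp.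
  by apply: eq_map_poly => b; rewrite /= rmorph_int.
by move=> Dgh; rewrite -!dvp -rootM -rmorphM -Dgh dvp dvdpp.
Qed.

(** Galois conjugation z -> z^t without a Galois group: irreducibility over [rat] makes [P] either a
    multiple of Phi_m, which also vanishes at the primitive root z^t, or coprime to it. *)
Lemma root_prim_root_exp (F : numFieldType) m (z : F) t (P : {poly rat}) :
  m.-primitive_root z -> coprime t m ->
  root (map_poly ratr P) z -> root (map_poly ratr P) (z ^+ t).
Proof.
move=> prz co_tm Pz; have m_gt0 := prim_order_gt0 prz.
pose Phi : {poly rat} := map_poly intr 'Phi_m.
have mapPhi : map_poly ratr Phi = map_poly (intr : int -> F) 'Phi_m.
  by rewrite -map_poly_comp; apply: eq_map_poly => b; rewrite /= rmorph_int.
have Phi0 : Phi != 0.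
  by rewrite map_poly_eq0_id0 ?monic_neq0 ?Cyclotomic_monic // (eqP (Cyclotomic_monic m)) oner_eq0.
have [h Dh] : exists h, Phi = h * gcdp P Phi by apply/dvdpP; exact: dvdp_gcdr.
have /orP[dvh | dvg] := Cyclotomic_irreducible m_gt0 Dh; last first.
  have /dvdpP[q ->] := dvdp_trans dvg (dvdp_gcdl _ _).
  by rewrite rmorphM rootM -/Phi /= mapPhi root_Cyclotomic ?prim_root_exp_coprime ?orbT.
(* Here [Phi] divides its own cofactor [h], so by degrees the gcd is constant and [P] cannot share
   the root [z] with [Phi]. *)
have sz : (size (gcdp P Phi) <= 1)%N.
  have := dvdp_leq _ dvh.
  have h0 : h != 0 by apply: contraNneq Phi0 => h0; rewrite Dh h0 mul0r.
  have g0 : gcdp P Phi != 0 by apply: contraNneq Phi0 => h1; rewrite Dh h1 mulr0.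
  rewrite -/Phi {1}Dh size_mul // => /(_ h0).
  have : (0 < size h)%N by rewrite lt0n size_poly_eq0.
  by case: (size h) => // s _; rewrite addSn /= -[leqRHS]addn1 leq_add2l.
have /coprimep_root : coprimep (map_poly (ratr : rat -> F) P) (map_poly ratr Phi).
  by rewrite coprimep_map /coprimep eqn_leq sz lt0n size_poly_eq0 gcdp_eq0 negb_and Phi0 orbT.
by move=> /(_ z Pz); rewrite mapPhi -[_ == 0]/(root _ z) root_Cyclotomic.
Qed.

Lemma prim_root_exists (F : numClosedFieldType) n :
  (n > 0)%N -> exists z : F, n.-primitive_root z.
Proof.
move=> n_gt0; have [r] := closed_field_poly_normal ('X^n - 1 : {poly F}).
rewrite (monicP _) ?monicXnsubC // scale1r => Dp.
have rn1 : all n.-unity_root r by apply/allP=> z; rewrite -root_prod_XsubC -Dp.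
have sz_r : (n < (size r).+1)%N by rewrite -(size_prod_XsubC r id) -Dp size_XnsubC.
have [|z] := hasP (has_prim_root n_gt0 rn1 _ sz_r); last by exists z.
by rewrite -separable_prod_XsubC -Dp separable_Xn_sub_1 // pnatr_eq0 -lt0n.
Qed.

(** Writing every [u i] as a power of one primitive m-th root turns the relation into a rational
    polynomial vanishing there, to which conjugation applies. *)
Lemma rat_relation_conj (F : numClosedFieldType) (I : finType) (J : {set I})
    (a : I -> rat) (u : I -> F) m t :
  (0 < m)%N -> (forall i, i \in J -> u i ^+ m = 1) -> coprime t m ->
  \sum_(i in J) ratr (a i) * u i = 0 -> \sum_(i in J) ratr (a i) * u i ^+ t = 0.
Proof.
move=> m_gt0 um co_tm rel; have [z prz] := prim_root_exists F m_gt0.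
have /fin_all_exists[e De] (i : I) : exists e : nat, i \in J -> u i = z ^+ e.
  case: (boolP (i \in J)) => [iJ | _]; last by exists 0%N.
  by have [e ->] := prim_rootP prz (um i iJ); exists e.
pose P : {poly rat} := \sum_(i in J) a i *: 'X^(e i).
have hP x : (map_poly ratr P).[x] = \sum_(i in J) ratr (a i) * x ^+ e i :> F.
  rewrite rmorph_sum horner_sum; apply: eq_bigr => i _ /=.
  by rewrite map_polyZ map_polyXn hornerZ hornerXn.
have: root (map_poly ratr P) (z ^+ t).
  apply: root_prim_root_exp prz co_tm _.
  rewrite rootE hP -[X in _ == X]rel; apply/eqP/eq_bigr => i iJ.
  by rewrite De.
rewrite rootE hP => /eqP rt; rewrite -[RHS]rt.
by apply: eq_bigr => i iJ; rewrite De // -!exprM mulnC.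
Qed.

Definition minimal_relation (F : nmodType) (I : finType) (J : {set I}) (c : I -> F) :=
  \sum_(i in J) c i = 0 /\
  forall K : {set I}, K != set0 -> K \proper J -> \sum_(i in K) c i != 0.

Lemma sum_unity_root (F : idomainType) p (w : F) : w ^+ p = 1 ->
  \sum_(s < p) w ^+ s = if w == 1 then p%:R else 0.
Proof.
move=> wp; case: eqVneq => [-> | w1].
  by under eq_bigr do rewrite expr1n; rewrite sumr_const card_ord.
have := subrX1 w p; rewrite wp subrr => /esym/eqP.
by rewrite mulf_eq0 subr_eq0 (negPf w1) => /eqP.
Qed.

Definition primorial n := (\prod_(p < n.+1 | prime p) p)%N.

(* Averaging the conjugates [u i ^+ t] of the relation over t = 1 mod m / p
   isolates the terms whose [m %/ p]-th power is 1. *)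
Lemma relation_descent (F : numClosedFieldType) (I : finType) (J : {set I})
    (a : I -> rat) (u : I -> F) (j0 : I) m p :
  minimal_relation J (fun i => ratr (a i) * u i) ->
  j0 \in J -> u j0 = 1 -> (0 < m)%N -> (forall i, i \in J -> u i ^+ m = 1) ->
  prime p -> (p %| m)%N -> (p %| m %/ p)%N || (#|J| < p)%N ->
  forall i, i \in J -> u i ^+ (m %/ p) = 1.
Proof.
move=> [rel minJ] j0J uj0 m_gt0 um p_pr p_dv_m hp.
have p_gt0 := prime_gt0 p_pr.
set n := (m %/ p)%N in hp *.
have Dm : m = (p * n)%N by rewrite mulnC divnK.
pose K (x : F) := [set i in J | (x * u i) ^+ n == 1].
(* [K 1] contains [j0], so once its partial sum vanishes, minimality forces [K 1 = J]. *)
suff /eqP : \sum_(i in K 1) ratr (a i) * u i == 0.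
  move=> K0 i iJ; have sKJ : K 1 \subset J by apply/subsetP => k; rewrite inE => /andP[].
  have : K 1 = J.
    apply/eqP; rewrite eqEproper sKJ; apply/negP => pKJ.
    have := minJ _ _ pKJ; rewrite K0 eqxx => /(_ _)/negP; apply => //.
    by apply/set0Pn; exists j0; rewrite inE j0J uj0 mulr1 expr1n eqxx.
  by move=> KJ; move: iJ; rewrite -KJ inE mul1r => /andP[_ /eqP].
pose T (x : F) t := \sum_(i in J) ratr (a i) * (x * u i) ^+ t.
have T0 x t : coprime t m -> T x t = 0.
  move=> co; rewrite /T; under eq_bigr do rewrite exprMn mulrCA.
  by rewrite -mulr_sumr (rat_relation_conj m_gt0 um co rel) mulr0.
(* Orthogonality: the sum of [((x * u i) ^+ n) ^+ s] over [s < p] is [p] on [K x] and zero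
   elsewhere. *)
have sumT x : x ^+ m = 1 ->
    \sum_(s < p) T x (1 + n * s)%N = p%:R * x * \sum_(i in K x) ratr (a i) * u i.
  move=> xm; rewrite exchange_big /= mulr_sumr (big_setID (K x)) /=.
  rewrite [X in _ + X]big1 ?addr0 => [|i]; last first.
    rewrite !inE => /andP[nK iJ]; rewrite iJ /= in nK.
    under eq_bigr do rewrite exprD exprM mulrA.
    by rewrite -mulr_sumr sum_unity_root ?(negPf nK) ?mulr0 // -exprM mulnC -Dm exprMn xm um ?mul1r.
  have -> : J :&: K x = K x by apply/setIidPr/subsetP => k; rewrite inE => /andP[].
  apply: eq_bigr => i; rewrite inE => /andP[iJ Ki].
  under eq_bigr do rewrite exprD exprM mulrA.
  rewrite -mulr_sumr sum_unity_root ?Ki ?expr1; last first.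
    by rewrite -exprM mulnC -Dm exprMn xm um ?mul1r.
  by rewrite [LHS]mulrC -mulrA; congr (_ * _); rewrite mulrCA.
have pF0 : p%:R != 0 :> F by rewrite pnatr_eq0 -lt0n.
have co_n s : coprime (1 + n * s) n.
  by rewrite coprime_sym -coprime_modr addnC mulnC modnMDl coprime_modr coprimen1.
have co_m s : ~~ (p %| 1 + n * s)%N -> coprime (1 + n * s) m.
  by move=> np; rewrite Dm coprimeMr co_n andbT coprime_sym prime_coprime.
(* Exponents prime to [m] contribute nothing, and exponents divisible by [p] absorb [x]; hence the
   sum is the same for all p-th roots of unity [x]. *)
have sumTp x : x ^+ p = 1 -> \sum_(s < p) T x (1 + n * s)%N =
    \sum_(s < p | (p %| 1 + n * s)%N) T 1 (1 + n * s)%N.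
  move=> xp; rewrite (bigID (fun s : 'I_p => p %| 1 + n * s)%N) /=.
  rewrite [X in _ + X]big1 ?addr0 => [|s np]; last by rewrite T0 ?co_m.
  apply: eq_bigr => s /dvdnP[q ->]; apply: eq_bigr => i _.
  by rewrite !exprMn expr1n [(q * p)%N]mulnC exprM xp expr1n.
(* If [p] divides [n], no exponent [1 + n * s] is a multiple of [p], so every term vanishes. *)
have [p_dv_n | npn] := boolP (p %| n)%N.
  have := sumT 1 (expr1n _ _); rewrite big1 => [/esym/eqP|s _].
    by rewrite mulr1 mulf_eq0 (negPf pF0).
  by apply/T0/co_m; rewrite dvdn_addl ?dvdn_mulr // gtnNdvd ?prime_gt1.
(* If the sum over [K 1] were nonzero, so would be the one over [K (e ^+ c)] for each [c < p].
   Picking an index in each of these sets gives [p] distinct elements of [J], against [#|J| < p]. *)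
rewrite (negPf npn) /= in hp; apply: contraLR hp => S1; rewrite -leqNgt.
have [e pre] := prim_root_exists F p_gt0.
have exp c : (e ^+ c) ^+ p = 1 by rewrite exprAC (prim_expr_order pre) expr1n.
have /fin_all_exists[f fP] (c : 'I_p) : exists i, i \in K (e ^+ c).
  apply/set0Pn; apply: contraNneq S1 => K0.
  have := sumT (e ^+ c); rewrite sumTp // Dm exprM exp expr1n => /(_ erefl).
  rewrite K0 big_set0 mulr0 -(sumTp 1) ?expr1n // sumT ?expr1n // => /eqP.
  by rewrite mulr1 mulf_eq0 (negPf pF0).
have injf : injective f.
  move=> c d fcd; have := fP c; have := fP d; rewrite -fcd !inE.
  case/andP=> iJ /eqP Ed /andP[_]; rewrite -Ed !exprMn.
  have un0 : u (f c) ^+ n != 0.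
    by apply: contraTneq (oner_neq0 F) => u0; rewrite -Ed exprMn u0 mulr0 eqxx.
  (* Since [p] does not divide [n], [e ^+ n] is still primitive, so an index lying in two of the
     sets would identify [c] and [d]. *)
  have pren : p.-primitive_root (e ^+ n).
    by rewrite prim_root_exp_coprime // coprime_sym prime_coprime.
  rewrite (can_eq (mulfK un0)) ![(e ^+ _) ^+ n]exprAC (eq_prim_root_expr pren).
  by rewrite !modn_small // => /eqP/val_inj.
rewrite -[p]card_ord -(card_imset _ injf); apply/subset_leq_card/subsetP => i.
by case/imsetP=> c _ ->; have := fP c; rewrite inE => /andP[].
Qed.

Lemma primorial_gt0 n : (0 < primorial n)%N.
Proof. by apply: prodn_cond_gt0 => p /prime_gt0. Qed.

Lemma dvdn_primorial p n : prime p -> (p <= n)%N -> (p %| primorial n)%N.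
Proof.
move=> p_pr le_pn; rewrite -ltnS in le_pn.
by rewrite /primorial (bigD1 (Ordinal le_pn)) //= dvdn_mulr.
Qed.

Lemma squarefree_dvdn_primorial m n : (0 < m)%N ->
  (forall p, prime p -> (p %| m)%N -> ~~ (p %| m %/ p)%N /\ (p <= n)%N) ->
  (m %| primorial n)%N.
Proof.
move=> m_gt0 hm; apply/(dvdn_partP _ m_gt0) => p.
rewrite mem_primes => /and3P[p_pr _ p_dv_m]; have [np le_pn] := hm p p_pr p_dv_m.
rewrite p_part (_ : logn p m = 1%N) ?expn1 ?dvdn_primorial //.
have n_gt0 : (0 < m %/ p)%N by rewrite divn_gt0 ?prime_gt0 // dvdn_leq.
have := lognM p n_gt0 (prime_gt0 p_pr); rewrite divnK // (logn_prime p p_pr) eqxx => ->.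
suff -> : logn p (m %/ p) = 0%N by [].
by apply/eqP; rewrite -leqn0 leqNgt logn_gt0 mem_primes p_pr n_gt0.
Qed.

(* Mann's theorem on vanishing sums of roots of unity. *)
Theorem minimal_relation_primorial (F : numClosedFieldType) (I : finType)
    (J : {set I}) (a : I -> rat) (u : I -> F) n :
  minimal_relation J (fun i => ratr (a i) * u i) ->
  (forall i, i \in J -> exists2 m, (0 < m)%N & u i ^+ m = 1) -> (#|J| <= n)%N ->
  forall i j, i \in J -> j \in J -> (u i / u j) ^+ primorial n = 1.
Proof.
move=> [rel minJ] um Jn i j iJ jJ.
have uj0 : u j != 0.
  have [m m_gt0 ujm] := um j jJ; apply: contraTneq (oner_neq0 F) => u0.
  by rewrite -ujm u0 expr0n gtn_eqF // eqxx.
(* Dividing by [u j] provides the term equal to 1 that the descent starts from. *)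
pose v k := u k / u j.
have relv : minimal_relation J (fun k => ratr (a k) * v k).
  split=> [|K K0 KJ]; under eq_bigr do rewrite mulrA; rewrite -mulr_suml ?rel ?mul0r //.
  by rewrite mulf_neq0 ?invr_eq0 ?minJ.
have [m [m_gt0 vm]] : exists m, (0 < m)%N /\ forall k, k \in J -> v k ^+ m = 1.
  have /fin_all_exists[g gP] k : exists m, (0 < m)%N /\ (k \in J -> u k ^+ m = 1).
    case: (boolP (k \in J)) => [kJ | _]; last by exists 1%N.
    by have [m m0 um'] := um k kJ; exists m.
  exists (\prod_k g k)%N; split; first by apply: prodn_gt0 => k; case: (gP k).
  move=> k kJ; rewrite expr_div_n.
  have pw l : l \in J -> u l ^+ (\prod_k g k) = 1.
    by move=> lJ; rewrite (bigD1 l) //= exprM (proj2 (gP l)) ?expr1n.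
  by rewrite !pw ?divr1.
(* Strong induction on a common exponent [m]: if [m] does not divide the primorial, some prime [p]
   has its square dividing [m] or exceeds [#|J|], and [relation_descent] replaces [m] by
   [m %/ p]. *)
elim/ltn_ind: m m_gt0 vm => m IHm m_gt0 vm.
case: (boolP (m %| primorial n)%N) => [/dvdnP[q ->] | ndv].
  by rewrite mulnC exprM vm ?expr1n.
have [p [p_pr p_dv_m hp]] : exists p, [/\ prime p, (p %| m)%N &
    (p %| m %/ p)%N || (#|J| < p)%N].
  have /allPn[p] : ~~ all (fun p => ~~ ((p %| m %/ p)%N || (#|J| < p)%N)) (primes m).
    apply: contra ndv => /allP hm; apply: squarefree_dvdn_primorial => // p p_pr pm.
    have := hm p; rewrite mem_primes p_pr m_gt0 pm negb_or -leqNgt => /(_ isT)/andP[-> pJ].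
    by split=> //; apply: leq_trans Jn.
  by rewrite mem_primes negbK => /and3P[p_pr _ pm] hp; exists p.
have p_gt1 := prime_gt1 p_pr.
apply: (IHm (m %/ p)%N); first by rewrite ltn_Pdiv.
  by rewrite divn_gt0 ?prime_gt0 // dvdn_leq.
by apply: (relation_descent relv jJ _ m_gt0 vm p_pr p_dv_m hp); rewrite /v divff.
Qed.

(** * Chebyshev-type bound on the primorial *)

Lemma prod_primes_dvdn (r : seq nat) n :
  uniq r -> {in r, forall p, prime p && (p %| n)%N} -> (\prod_(p <- r) p %| n)%N.
Proof.
elim: r => [|p r IHr] /=; first by rewrite big_nil dvd1n.
case/andP=> pr' ur hr; rewrite big_cons.
have /andP[p_pr p_dv_n] := hr p (mem_head p r).
have hr' q : q \in r -> prime q && (q %| n)%N by move=> qr; rewrite hr // inE qr orbT.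
rewrite Gauss_dvd ?p_dv_n ?IHr // big_seq.
apply: (big_rec (fun m => coprime p m)) => [|q m qr co]; first exact: coprimen1.
have /andP[q_pr _] := hr' q qr.
rewrite coprimeMr co andbT prime_coprime // dvdn_prime2 //.
by apply: contraNneq pr' => ->.
Qed.

(** C(2m+1, m) and C(2m+1, m+1) are equal and are two of the terms in the expansion of (1 +
    1)^(2m+1) = 2 * 4^m. *)
Lemma bin_middle_le m : ('C(m.*2.+1, m.+1) <= 4 ^ m)%N.
Proof.
rewrite -(@leq_pmul2l 2) // -(expnM 2 2) -expnS [(2 * m)%N]mul2n -[(2 ^ _)%N]/((1 + 1) ^ _)%N Pascal.
have lt1 : (m < m.*2.+2)%N by rewrite ltnS leqW // -addnn leq_addr.
have lt2 : (m.+1 < m.*2.+2)%N by rewrite !ltnS -addnn leq_addr.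
rewrite (bigD1 (Ordinal lt1)) // (bigD1 (Ordinal lt2)) /=; last by rewrite -val_eqE /= gtn_eqF.
rewrite !exp1n !muln1 addnA mul2n; apply: leq_trans (leq_addr _ _).
rewrite -[X in (X + _)%N]bin_sub; last by rewrite -addnn ltnW // ltnS leq_addr.
have -> : (m.*2.+1 - m = m.+1)%N by rewrite -addnn -addSn addnK.
by rewrite addnn.
Qed.

(* The primes in (m+1, 2m+1] all divide the binomial coefficient C(2m+1, m+1). *)
Lemma primorial_le n : (primorial n <= 4 ^ n)%N.
Proof.
have primorialS k : primorial k.+1 = (primorial k * (if prime k.+1 then k.+1 else 1))%N.
  by rewrite /primorial big_mkcond big_ord_recr -big_mkcond.
elim/ltn_ind: n => -[|n] IHn; first by rewrite /primorial big_mkcond big_ord_recr big_ord0.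
case: (boolP (odd n.+1)) => [/= odd_n | ev]; last first.
  have [-> | n1] := eqVneq n 1%N.
    by rewrite /primorial big_mkcond !big_ord_recr big_ord0.
  rewrite primorialS; case: ifP => [/even_prime[[] /eqP | od]|_].
  - by rewrite (negPf n1).
  - by rewrite od in ev.
  by rewrite muln1 expnS (leq_trans (IHn n _)) // leq_pmull.
set m := n./2.
have Dn : n.+1 = m.*2.+1 by rewrite -[n in LHS]odd_double_half (negPf odd_n).
have [-> | m_gt0] := posnP n; first by rewrite /primorial big_mkcond !big_ord_recr big_ord0.
have lemn : (m.+1 < n.+1)%N.
  rewrite Dn ltnS -addnn -ltn_subLR // subnn.
  by rewrite lt0n; apply: contraTneq m_gt0 => m0; have := Dn; rewrite m0 => -[->].
(* The primes up to m+1 contribute at most 4^(m+1) by induction, the remaining ones at most 4^m. *)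
rewrite {1}/primorial -(big_mkord (fun p => prime p) id) (@big_cat_nat _ _ _ m.+2) //=; last exact: ltnW.
rewrite (big_mkord (fun p => prime p) id) -/(primorial m.+1).
have -> : (4 ^ n.+1 = 4 ^ m.+1 * 4 ^ m)%N by rewrite -expnD Dn -addnn addSn.
rewrite leq_mul ?IHn //; apply: leq_trans (bin_middle_le m).
apply: dvdn_leq; first by rewrite bin_gt0 ltnS -addnn leq_addr.
rewrite -big_filter; apply: prod_primes_dvdn => [|p].
  by rewrite filter_uniq // iota_uniq.
rewrite mem_filter mem_index_iota => /and3P[p_pr ltmp lepn]; rewrite p_pr.
have le_mm : (m.+1 <= m.*2.+1)%N by rewrite ltnS -addnn leq_addr.
have := dvdn_fact (n := m.*2.+1) (m := p); rewrite prime_gt0 // -Dn -ltnS lepn => /(_ isT).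
rewrite Dn -(bin_fact le_mm) Euclid_dvdM // (Euclid_dvdM (m.+1)`!) //.
(* A prime above m+1 divides (2m+1)! but neither (m+1)! nor m!, hence it divides the binomial
   coefficient. *)
have nd k : (k < p)%N -> (p %| k`!)%N = false.
  elim: k => [|k IHk] ltkp; first by rewrite fact0 gtnNdvd ?prime_gt1.
  by rewrite factS Euclid_dvdM // IHk ?(ltnW ltkp) // gtnNdvd.
rewrite (nd m.+1) // (nd (m.*2.+1 - m.+1)%N) ?orbF //.
by rewrite subSS -addnn addnK; apply: leq_trans ltmp.
Qed.

(** * Irredundant walks *)

Fixpoint subsums (V : zmodType) (s : seq V) : seq V :=
  if s is x :: s' then subsums s' ++ [seq x + y | y <- subsums s'] else [:: 0].

(** Testing each step as it is added makes at most [2 ^ size s'] values of [x] fail. The empty sum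
    is among the subsums, so a zero step fails as well. *)
Fixpoint irredundant (V : zmodType) (s : seq V) : bool :=
  if s is x :: s' then (- x \notin subsums s') && irredundant s' else true.

Lemma size_subsums (V : zmodType) (s : seq V) : size (subsums s) = (2 ^ size s)%N.
Proof. by elim: s => //= x s IHs; rewrite size_cat size_map IHs addnn expnS mul2n. Qed.

Lemma mem_subsums (V : zmodType) (s : seq V) (P : pred 'I_(size s)) :
  \sum_(i < size s | P i) s`_i \in subsums s.
Proof.
elim: s P => [|x s IHs] P; first by rewrite big_ord0 mem_head.
rewrite big_mkcond big_ord_recl -big_mkcond /= mem_cat.
case: (P ord0); last by rewrite add0r IHs.
by rewrite map_f ?orbT // (IHs (fun i => P (lift ord0 i))).
Qed.

(** If [x] is the first selected entry, a vanishing sum would make [- x] a subsum of the entries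
    after it. *)
Lemma irredundant_sum_neq0 (V : zmodType) (s : seq V) (P : pred 'I_(size s)) i :
  irredundant s -> P i -> \sum_(i < size s | P i) s`_i != 0.
Proof.
elim: s P i => [|x s IHs] P i; first by case: i.
case/andP=> xs irs Pi; rewrite big_mkcond big_ord_recl -big_mkcond /=.
case: ifP => P0.
  apply: contra xs => /eqP/(canRL (addKr _)); rewrite addr0 => <-.
  exact: (mem_subsums (fun i : 'I_(size s) => P (lift ord0 i))).
rewrite add0r; have [j Dj|Di] := unliftP ord0 i; last by rewrite -Di Pi in P0.
by apply: (IHs (fun i => P (lift ord0 i)) j irs); rewrite -Dj.
Qed.

Lemma irredundant_neq0 (V : zmodType) (s : seq V) (i : 'I_(size s)) :
  irredundant s -> s`_i != 0.
Proof.
by move=> irs; have := irredundant_sum_neq0 (P := pred1 i) irs (eqxx i); rewrite big_pred1_eq.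
Qed.

Definition rat_unity (F : numFieldType) (d : F) :=
  exists (a : rat) (u : F) (m : nat), [/\ (0 < m)%N, u ^+ m = 1 & d = ratr a * u].

(** Take [J] minimal among the vanishing sets containing [j]. A smaller nonempty vanishing [K]
    either contains [j], or leaves the vanishing set [J :\: K] that does; both contradict the
    choice. *)
Lemma exists_minimal_relation (V : zmodType) (I : finType) (c : I -> V) (j : I) :
  \sum_i c i = 0 -> exists2 J : {set I}, j \in J & minimal_relation J c.
Proof.
move=> c0; pose P (J : {set I}) := (j \in J) && (\sum_(i in J) c i == 0).
have [|J /minsetP[/andP[jJ /eqP J0] minJ]] := @ex_minset _ P.
  exists setT; rewrite /P inE -[X in _ == X]c0 /=; apply/eqP/eq_bigl => i.
  by rewrite inE.
exists J => //; split=> // K K0 pKJ; have sKJ := proper_sub pKJ.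
apply/negP => /eqP sK; have [jK | njK] := boolP (j \in K).
  have := minJ K; rewrite /P jK sK eqxx => /(_ isT sKJ) KJ.
  by rewrite KJ properxx in pKJ.
have DK : J :&: K = K by apply/setIidPr.
have /minJ : P (J :\: K).
  by move: J0; rewrite /P inE jJ njK (big_setID K) DK /= sK add0r => ->; rewrite eqxx.
rewrite subsetDl => /(_ isT) JK; have /set0Pn[i iK] := K0.
by have := subsetP sKJ i iK; rewrite -JK inE iK.
Qed.

(** For fixed [s] this confines [d] to the [size s * M] directions [z ^+ c * a], up to rational
    factors. *)
Definition aligned (F : numFieldType) (z : F) M (s : seq F) (d : F) :=
  (d != 0) && has (fun a => [exists c : 'I_M, `[< exists q, d = ratr q * z ^+ c * a >]]) s.

Lemma irredundant_aligned (F : numClosedFieldType) (z : F) n (s t : seq F) :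
  (primorial n).-primitive_root z -> (size s + size t <= n)%N ->
  irredundant s -> irredundant t -> \sum_(d <- s) d = \sum_(d <- t) d ->
  (forall d, d \in s -> rat_unity d) -> (forall d, d \in t -> rat_unity d) ->
  all (aligned z (primorial n) s) t.
Proof.
move=> prz le_n irs irt est us ut; apply/(all_nthP 0) => j0 ltj.
set j := Ordinal ltj; rewrite -[j0]/(val j) /aligned irredundant_neq0 //=.
pose c (i : 'I_(size s) + 'I_(size t)) :=
  match i with inl i => s`_i | inr i => - t`_i end.
have /fin_all_exists[a] i : exists a (u : F) m, [/\ (0 < m)%N, u ^+ m = 1 & c i = ratr a * u].
  case: i => i; first by apply: us; exact: mem_nth.
  have [a [u [m [m0 um Dt]]]] := ut t`_i (mem_nth _ (ltn_ord i)).
  by exists (- a), u, m; rewrite /= Dt rmorphN mulNr.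
case/fin_all_exists=> u /fin_all_exists[m Dc].
have c0 : \sum_i c i = 0.
  move: est; rewrite (big_nth 0) [RHS](big_nth 0) !big_mkord => est.
  by rewrite big_sumType /= sumrN est subrr.
have [J jJ minJ] := exists_minimal_relation (inr j) c0.
(* Otherwise the relation would be a vanishing subsum of [t] alone, which irredundance forbids. *)
have [i iJ] : exists i, inl i \in J.
  apply/existsP; apply: contraT => /existsPn nJ; case: minJ => + _.
  rewrite big_mkcond big_sumType /= big1 ?add0r => [|i _]; last by rewrite (negPf (nJ i)).
  rewrite -big_mkcond sumrN => /eqP; rewrite oppr_eq0.
  by rewrite (negPf (irredundant_sum_neq0 (P := fun i => inr i \in J) irt jJ)).
have uM : (u (inr j) / u (inl i)) ^+ primorial n = 1.
  apply: (@minimal_relation_primorial _ _ J a) => // [|k _|]; last 1 first.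
  - by rewrite (leq_trans (max_card _)) // card_sum !card_ord.
  - by move: minJ; congr minimal_relation; apply: funext => k; case: (Dc k).
  by exists (m k); case: (Dc k).
have [e De] := prim_rootP prz uM.
apply/(has_nthP 0); exists i => //; apply/existsP; exists e; apply/asboolP.
have [_ _ Di] := Dc (inl i); have [_ _ Dj] := Dc (inr j).
have : c (inl i) != 0 by rewrite /= irredundant_neq0.
rewrite Di mulf_eq0 negb_or => /andP[ai ui].
exists (- (a (inr j) / a (inl i))); rewrite -De -[s`_i]/(c (inl i)) Di.
rewrite -[t`_j]opprK -[- t`_j]/(c (inr j)) Dj rmorphN fmorph_div !mulNr.
by congr (- _); rewrite mulrACA !divfK.
Qed.

(** * Counting walks from below and from above *)

Definition position (V : zmodType) (v : V) (s : seq V) := v + \sum_(d <- s) d.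

(* Counts the extensions of [s] by [k] steps that stay in [T] and satisfy [F];
   a walk from [v] is the list of its step vectors, most recent first. *)
Fixpoint nwalks (V : zmodType) (T : seq V) (v : V) (F : pred (seq V)) k s : nat :=
  if k is k'.+1 then (\sum_(x <- T) nwalks T v F k' ((x - position v s)%R :: s))%N
  else F s.

Lemma position_cons (V : zmodType) (v x : V) s :
  position v (x - position v s :: s) = x.
Proof. by rewrite /position big_cons opprD [x + _]addrA addrNK addrCA subrr addr0. Qed.

Lemma sum_count (I : Type) (r : seq I) (P : pred I) : (\sum_(i <- r) P i)%N = count P r.
Proof. by rewrite -sum1_count [RHS]big_mkcond; apply: eq_bigr => i _; case: (P i). Qed.

Lemma leq_sum_seq_in (I : eqType) (r : seq I) (f g : I -> nat) :
  {in r, forall i, (f i <= g i)%N} -> (\sum_(i <- r) f i <= \sum_(i <- r) g i)%N.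
Proof. by move=> le_fg; rewrite !big_seq leq_sum. Qed.

(** The cap [n] allows a uniform [b]: the number of steps that irredundance may exclude,
    [2 ^ size s], grows with the length. *)
Lemma nwalks_lower (V : zmodType) (T : seq V) v (F : pred (seq V)) b n :
  (forall s, F s -> position v s \in T -> (size s < n)%N ->
    (b <= count (fun x => F (x - position v s :: s)%R) T)%N) ->
  forall k s, F s -> position v s \in T -> (k + size s <= n)%N ->
    (b ^ k <= nwalks T v F k s)%N.
Proof.
move=> hb; elim=> [|k IHk] s Fs sT le_n; first by rewrite /= Fs.
have lt_n : (size s < n)%N by apply: leq_trans le_n; rewrite addSn ltnS leq_addl.
apply: (@leq_trans (\sum_(x <- T) F (x - position v s :: s)%R * b ^ k)%N).
  by rewrite -big_distrl /= sum_count expnS leq_mul2r hb ?orbT.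
apply: leq_sum_seq_in => x xT; case: (boolP (F _)) => // Fx; rewrite mul1n.
by apply: IHk; rewrite ?position_cons //= addnS -addSn.
Qed.

(** The factor [F s] carries the induction: a list failing [F] has no extension satisfying it, so
    both sides are then zero. *)
Lemma nwalks_upper (V : zmodType) (T : seq V) v (F : pred (seq V)) B :
  (forall d s, F (d :: s) -> F s) ->
  (forall s, position v s \in T -> (count (fun x => F (x - position v s :: s)%R) T <= B)%N) ->
  forall k s, position v s \in T -> (nwalks T v F k s <= F s * B ^ k)%N.
Proof.
move=> hF hB; elim=> [|k IHk] s sT; first by rewrite muln1.
apply: (@leq_trans (\sum_(x <- T) F (x - position v s :: s)%R * B ^ k)%N).
  by apply: leq_sum_seq_in => x xT; rewrite IHk // position_cons.
rewrite -big_distrl /= sum_count expnS mulnA leq_mul2r; apply/orP; right.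
case: (boolP (F s)) => [_ | nFs]; first by rewrite mul1n hB.
rewrite mul0n leqn0 -leqn0 leqNgt -has_count; apply/hasPn => x _.
by apply: contra nFs => /hF.
Qed.

Lemma nwalks_mono (V : zmodType) (T : seq V) v (F G : pred (seq V)) k s :
  (forall r, size r = (k + size s)%N -> F r -> G r) ->
  (nwalks T v F k s <= nwalks T v G k s)%N.
Proof.
elim: k s => [|k IHk] s FG /=; first by case: (boolP (F s)) => // /FG ->.
by apply: leq_sum => x _; apply: IHk => r sr; apply: FG; rewrite sr addSnnS.
Qed.

Lemma nwalks_gt0 (V : zmodType) (T : seq V) v (F : pred (seq V)) k s :
  (0 < nwalks T v F k s)%N -> exists2 r, size r = (k + size s)%N & F r.
Proof.
elim: k s => [|k IHk] s /=; first by case: (boolP (F s)) => // Fs _; exists s.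
rewrite lt0n sum_nat_seq_neq0 => /hasP[x _]; rewrite -lt0n => /IHk[r sr Fr].
by exists r; rewrite // sr addSnnS.
Qed.

Lemma nwalks_endpoint (V : zmodType) (T : seq V) v (F : pred (seq V)) k s :
  position v s \in T ->
  (nwalks T v F k s <=
    \sum_(w <- T) nwalks T v (fun r => F r && (position v r == w)) k s)%N.
Proof.
elim: k s => [|k IHk] s sT /=.
  by rewrite (big_rem _ sT) /= eqxx andbT leq_addr.
rewrite exchange_big; apply: leq_sum_seq_in => x xT.
by apply: IHk; rewrite position_cons.
Qed.

Lemma count_le1 (I : eqType) (r : seq I) (P : pred I) : uniq r ->
  (forall x y, x \in r -> y \in r -> P x -> P y -> x = y) -> (count P r <= 1)%N.
Proof.
move=> ur P1; rewrite -size_filter.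
case Dr: (filter P r) => [|x [|y s]] //.
have uf : uniq (filter P r) by rewrite filter_uniq.
have : x \in filter P r by rewrite Dr mem_head.
have : y \in filter P r by rewrite Dr inE mem_head orbT.
rewrite !mem_filter => /andP[Py yr] /andP[Px xr].
by move: uf; rewrite Dr (P1 x y) // /= mem_head.
Qed.

(** Each pair of [a] in [s] and exponent [c] accounts for at most one [x]: two of them would differ
    from [y] by rational multiples of the same number. *)
Lemma count_aligned (F : numFieldType) (z : F) M (s T : seq F) y :
  uniq T ->
  (forall x x', x \in T -> x' \in T -> y != x -> y != x' -> x != x' ->
    forall q : rat, x - y != ratr q * (x' - y)) ->
  (count (fun x => aligned z M s (x - y)%R) T <= size s * M)%N.
Proof.
move=> uT nocol.
pose P a (c : 'I_M) x := (x != y) && `[< exists q : rat, x - y = ratr q * z ^+ c * a >].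
apply: (@leq_trans (\sum_(x <- T) \sum_(a <- s) \sum_(c < M) P a c x)%N).
  rewrite -sum_count; apply: leq_sum => x _; rewrite /aligned subr_eq0.
  case: (boolP (x != y)) => //= xy; case: hasP => //= -[a sa /existsP[c Pc]].
  by rewrite (big_rem a) //= (bigD1 c) //= /P xy Pc.
rewrite exchange_big /=; apply: (@leq_trans (\sum_(a <- s) M)%N); last first.
  by rewrite big_const_seq count_predT iter_addn_0 mulnC.
apply: leq_sum => a _; rewrite exchange_big /= -[leqRHS]card_ord -sum1_card.
apply: leq_sum => c _; rewrite sum_count; apply: count_le1 => // x x' xT x'T.
case/andP=> xy /asboolP[q Dx] /andP[x'y /asboolP[q' Dx']].
apply/eqP; apply: contraT => xx'.
have q'0 : ratr q' != 0 :> F.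
  by apply: contraNneq x'y => q0; rewrite -subr_eq0 Dx' q0 !mul0r.
rewrite eq_sym in xy; rewrite eq_sym in x'y.
have /eqP[] := nocol x x' xT x'T xy x'y xx' (q / q').
rewrite Dx fmorph_div /=.
by move: (ratr q') q'0 Dx' => r r0 ->; rewrite !mulrA divfK.
Qed.

Fixpoint walk (V : zmodType) (e : rel V) (v : V) (s : seq V) : bool :=
  if s is d :: s' then [&& e (position v s') (position v s),
    - d \notin subsums s' & walk e v s'] else true.

Lemma walk_irredundant (V : zmodType) (e : rel V) v s : walk e v s -> irredundant s.
Proof. by elim: s => //= d s IHs /and3P[_ -> /IHs]. Qed.

(** Each of the [2 ^ size s] subsums rules out a single next point. The subtraction is truncated, so
    the claim is trivial for small degrees. *)
Lemma count_walk (V : zmodType) (T : seq V) (e : rel V) v s : uniq T -> walk e v s ->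
  (count (e (position v s)) T - 2 ^ size s <=
    count (fun x => walk e v (x - position v s :: s)%R) T)%N.
Proof.
move=> uT ws; rewrite leq_subLR -size_subsums.
set p := position v s.
have le_bad : (count (fun x => (- (x - p))%R \in subsums s) T <= size (subsums s))%N.
  rewrite -size_filter -(size_map (fun x => - (x - p))) uniq_leq_size //.
    by rewrite map_inj_uniq ?filter_uniq // => x y /oppr_inj/addIr.
  by move=> _ /mapP[x + ->]; rewrite mem_filter => /andP[].
apply: leq_trans (leq_add le_bad (leqnn _)); rewrite -count_predUI.
apply: leq_trans (leq_addr _ _); apply: sub_count => x ex /=.
by rewrite position_cons ws ex andbT /= orbN.
Qed.

Theorem rat_unity_degree_bound (F : numClosedFieldType) (T : seq F) (e : rel F) k D x0 :
  uniq T -> x0 \in T ->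
  (forall x y, e x y -> rat_unity (y - x)) ->
  (forall y x x', y \in T -> x \in T -> x' \in T -> y != x -> y != x' -> x != x' ->
    forall q : rat, x - y != ratr q * (x' - y)) ->
  (forall x, x \in T -> D <= count (e x) T)%N ->
  ((D - 2 ^ k) ^ k <= size T * (k * 4 ^ k.*2) ^ k)%N.
Proof.
move=> uT x0T eru nocol degT; set W := walk e x0.
have pos0 : position x0 [::] \in T by rewrite /position big_nil addr0.
have low : ((D - 2 ^ k) ^ k <= nwalks T x0 W k [::])%N.
  apply: (nwalks_lower (n := k)) => //; last by rewrite addn0.
  move=> s Ws sT lt_sk; apply: leq_trans (count_walk uT Ws).
  by rewrite leq_sub ?degT // leq_exp2l // ltnW.
apply: leq_trans low _; apply: leq_trans (nwalks_endpoint _ _ pos0) _.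
rewrite -sum1_size big_distrl /=; apply: leq_sum_seq_in => w wT; rewrite mul1n.
(* If any walk ends at [w], one such walk [s] is fixed as a reference, and all the others are
   aligned with it. *)
set f := (fun r => _); have [-> // | fN0] := posnP (nwalks T x0 f k [::]).
have [s] := nwalks_gt0 fN0; rewrite addn0 => sz_s /andP[Ws /eqP sw].
(* Two walks of [k] steps give a relation of [2k] terms, whence the primorial of [k.*2]. *)
have [z prz] := prim_root_exists F (primorial_gt0 k.*2).
pose G := all (aligned z (primorial k.*2) s).
have ruW r : W r -> forall d, d \in r -> rat_unity d.
  elim: r => //= d r IHr /and3P[er _ Wr] d'; rewrite inE => /predU1P[-> | /(IHr Wr)//].
  move/eru: er; rewrite /position big_cons.
  by rewrite (addrCA x0) addrK.
apply: (@leq_trans (nwalks T x0 G k [::])).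
  apply: nwalks_mono => r; rewrite addn0 => sz_r /andP[Wr /eqP rw].
  apply: irredundant_aligned => //; first by rewrite sz_s sz_r addnn.
  - exact: walk_irredundant Ws.
  - exact: walk_irredundant Wr.
  - by apply: (addrI x0); rewrite -/(position x0 s) sw -rw.
  - exact: ruW.
  - exact: ruW.
apply: leq_trans (nwalks_upper (B := size s * primorial k.*2) _ _ _ pos0) _.
- by move=> d r /andP[].
- move=> r rT; apply: leq_trans (count_aligned z _ _ uT (fun x x' => nocol _ x x' rT)).
  by apply: sub_count => x; rewrite /G /= => /andP[].
rewrite mul1n; have [k0 | k0] := posnP k.
  by rewrite [X in (_ ^ X <= _)%N]k0 [X in (_ <= _ ^ X)%N]k0.
by rewrite leq_exp2r // sz_s leq_mul2l primorial_le orbT.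
Qed.

(** * The graph of rational distances and angles *)

Fixpoint npairs (T : eqType) (e : rel T) (s : seq T) : nat :=
  if s is x :: s' then (count (e x) s' + npairs e s')%N else 0%N.

Lemma npairs_rem (T : eqType) (e : rel T) (s : seq T) x : symmetric e -> x \in s ->
  npairs e s = (count (e x) (rem x s) + npairs e (rem x s))%N.
Proof.
move=> sym_e; elim: s => // y s IHs; rewrite inE /=.
have [-> // | yx /= xs] := eqVneq y x.
rewrite IHs // (permP (perm_to_rem xs)) /= sym_e.
by rewrite -!addnA; congr (_ + _)%N; rewrite addnCA.
Qed.

(* Repeatedly delete a vertex of degree at most d. *)
Lemma npairs_degenerate (T : eqType) (e : rel T) (s : seq T) d : symmetric e -> uniq s ->
  (forall t : seq T, t != [::] -> uniq t -> {subset t <= s} ->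
    exists2 x, x \in t & (count (e x) t <= d)%N) ->
  (npairs e s <= size s * d)%N.
Proof.
move=> sym_e; move Dn: (size s) => n; elim: n s Dn => [|n IHn] s Dn us low.
  by case: s Dn {us low}.
have [||//|x xs dx] := low s; first by case: s Dn {us low}.
  by [].
rewrite (npairs_rem sym_e xs) mulSn leq_add //.
  by apply: leq_trans dx; rewrite (permP (perm_to_rem xs)) /= leq_addl.
apply: IHn; first by rewrite size_rem // Dn.
  exact: rem_uniq.
by move=> t t0 ut sts; apply: low => // y /sts /mem_rem.
Qed.

Lemma npairs_le_sqr (T : eqType) (e : rel T) (s : seq T) : (npairs e s <= size s * size s)%N.
Proof.
elim: s => //= x s IHs; rewrite mulSn.
apply: leq_add; first by rewrite (leq_trans (count_size _ _)).
by rewrite (leq_trans IHs) // leq_mul2l leqnSn orbT.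
Qed.

(* Translation of the real definitions into complex numbers *)
Delimit Scope R_scope with coqR.
Notation R := Rdefinitions.R.
Notation C := (complex R).

Definition to_complex (p : point) : C := (p.1 +i* p.2)%C.
Lemma to_complex_inj : injective to_complex.
Proof. by move=> [a b] [c d] [-> ->]. Qed.

Lemma IZR_int (a : Z) : exists m : int, IZR a = m%:~R.
Proof.
case: a => [|p|p]; first by exists 0.
  by exists (Pos.to_nat p)%:Z; rewrite -[LHS]/(IPR p) -INR_IPR INRE.
by exists (- (Pos.to_nat p)%:Z); rewrite -[LHS]/(- IPR p) -INR_IPR INRE rmorphN.
Qed.

Lemma Rrational_ratr (x : R) : Rrational x -> exists q : rat, x = ratr q.
Proof.
case=> a [b [_ ->]]; have [m ->] := IZR_int a; have [n ->] := IZR_int b.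
by exists (m%:~R / n%:~R); rewrite fmorph_div !rmorph_int.
Qed.

Definition cis (t : R) : C := (cos t +i* sin t)%C.

Lemma cisX t n : cis t ^+ n = cis (INR n * t)%coqR.
Proof.
elim: n => [|n IHn]; first by rewrite expr0 /cis Rmult_0_l cos_0 sin_0.
rewrite exprS IHn S_INR Rmult_plus_distr_r Rmult_1_l Rplus_comm /cis cos_plus sin_plus.
by congr (_ +i* _)%C; rewrite ?RminusE ?RplusE ?RmultE [in RHS]addrC.
Qed.

Lemma cis_2pi (a : Z) : cis (2 * IZR a * PI)%coqR = 1.
Proof.
have cis_nat n : cis (2 * INR n * PI)%coqR = 1.
  have := cos_period 0 n; have := sin_period 0 n.
  by rewrite /cis Rplus_0_l cos_0 sin_0 => -> ->.
case: a => [|p|p]; first by rewrite -(cis_nat 0%N).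
  by rewrite -(cis_nat (Pos.to_nat p)) INR_IPR.
have -> : (2 * IZR (Z.neg p) * PI = - (2 * INR (Pos.to_nat p) * PI))%coqR.
  by rewrite -[IZR (Z.neg p)]/(- IPR p)%coqR INR_IPR; lra.
have := cis_nat (Pos.to_nat p).
by rewrite /cis cos_neg sin_neg => -[-> ->]; rewrite Ropp_0.
Qed.

Lemma cis_rat_unity (g : R) : Rrational g ->
  exists2 m, (0 < m)%N & cis (PI * g)%coqR ^+ m = 1.
Proof.
(* With [g = a / b], multiplying the angle by [2 * |b|] gives 2 pi times the integer [a * sgn b]. *)
case=> a [b [b0 ->]]; exists (Z.to_nat (2 * Z.abs b)); first by apply/ssrnat.ltP; lia.
rewrite cisX INR_IZR_INZ Z2Nat.id; last by lia.
rewrite -(cis_2pi (a * Z.sgn b)); congr cis.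
have b0' : IZR b <> 0%coqR by apply: not_0_IZR.
by rewrite -Z.sgn_abs !mult_IZR; field.
Qed.

(** The modulus [r] in the polar form is the distance itself, hence rational. *)
Lemma good_pair_rat_unity (p q : point) : good_pair p q ->
  rat_unity (to_complex q - to_complex p).
Proof.
case: p q => [p1 p2] [q1 q2] [rat_d [_ [r [g [r0 [rat_g []]]]]]] /= D1 D2.
have Dr : dist2 (p1, p2) (q1, q2) = r.
  rewrite /dist2 /= D1 D2.
  have -> : ((r * cos (PI * g)) ^ 2 + (r * sin (PI * g)) ^ 2 = r ^ 2)%coqR.
    have := sin2_cos2 (PI * g); rewrite /Rsqr => E.
    by transitivity (r ^ 2 * (sin (PI * g) * sin (PI * g) + cos (PI * g) * cos (PI * g)))%coqR; [ring | rewrite E; ring].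
  by rewrite sqrt_pow2 //; lra.
have [c Dc] := Rrational_ratr rat_d.
have [m m0 um] := cis_rat_unity rat_g.
exists c, (cis (PI * g)%coqR), m; split=> //.
rewrite -(fmorph_rat (real_complex R)) -Dc Dr.
apply/eqP; rewrite eq_complex /= !mul0r subr0 addr0 -!RminusE D1 D2 !eqxx //.
Qed.

Definition rat_edge (x y : C) : bool := `[< rat_unity (y - x) >].

Lemma rat_edge_sym : symmetric rat_edge.
Proof.
suff sub x y : rat_edge x y -> rat_edge y x by move=> x y; apply/idP/idP; apply: sub.
move=> /asboolP[a [u [m [m0 um D]]]]; apply/asboolP; exists (- a), u, m.
by rewrite rmorphN mulNr -D opprB.
Qed.

Lemma count_pairs_le_npairs (S : seq point) :
  (count_pairs good_pair S <= npairs rat_edge (map to_complex S))%N.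
Proof.
elim: S => //= p S IHS; apply: leq_add => //.
elim: S {IHS} => //= q S IHS; apply: leq_add => //.
rewrite /indic; case: ClassicalDescription.excluded_middle_informative => // /good_pair_rat_unity pq.
by rewrite /rat_edge asboolT.
Qed.

Lemma InP (T : eqType) (x : T) (s : seq T) : reflect (List.In x s) (x \in s).
Proof.
elim: s => /= [|y s IHs]; first by apply: ReflectF.
by rewrite inE eq_sym; apply: (iffP orP) => -[/eqP|/IHs]; by [left | right].
Qed.

Lemma NoDup_uniq (T : eqType) (s : seq T) : List.NoDup s -> uniq s.
Proof. by elim => //= x r /InP -> _ ->. Qed.

Lemma no_three_collinear_complex (S : seq point) : no_three_collinear S ->
  forall y x x' : C, y \in map to_complex S -> x \in map to_complex S ->
    x' \in map to_complex S -> y != x -> y != x' -> x != x' ->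
    forall q : rat, x - y != ratr q * (x' - y).
Proof.
move=> nocol _ _ _ /mapP[p /InP pS ->] /mapP[p' /InP p'S ->] /mapP[p'' /InP p''S ->].
rewrite !(inj_eq to_complex_inj) => /eqP pp' /eqP pp'' /eqP p'p'' q.
apply/eqP; rewrite -(fmorph_rat (real_complex R)) => /eqP; rewrite eq_complex /=.
move: (nocol p p' p'' pS p'S p''S pp' p'p'' pp'').
rewrite !mul0r subr0 addr0 -!RminusE -!RmultE => H /andP[/eqP E1 /eqP E2].
by apply: H; rewrite E1 E2; ring.
Qed.

(** * Assembling the bound *)

Lemma INR_expn m n : INR (expn m n) = pow (INR m) n.
Proof. by rewrite RpowE !INRE natrX. Qed.

Lemma npairs_rat_edge_bound (T : seq C) (L : R) :
  (6 < L)%coqR -> (INR (size T) <= exp (L * L))%coqR -> uniq T ->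
  (forall y x x', y \in T -> x \in T -> x' \in T -> y != x -> y != x' -> x != x' ->
    forall q : rat, x - y != ratr q * (x' - y)) ->
  (INR (npairs rat_edge T) <= INR (size T) * exp (6 * L))%coqR.
Proof.
move=> L6 leT uT nocol.
(* The parameters depend on [size T] only and serve every [t] inside [T], as [size t <= size T]. *)
have [k [d [led [le2k lt]]]] := walk_count_parameters L (INR (size T)) L6 (conj (pos_INR _) leT).
apply: Rle_trans (Rmult_le_compat_l _ _ _ (pos_INR _) led).
rewrite -mult_INR; apply/le_INR/ssrnat.leP; apply: npairs_degenerate => //.
  exact: rat_edge_sym.
move=> t; case Dt: t => [//|x0 t'] _; rewrite -Dt => ut tT.
have x0t : x0 \in t by rewrite Dt mem_head.
suff /hasP[x xt dx] : has (fun x => (count (rat_edge x) t <= d)%N) t by exists x.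
apply/negP => /negP/hasPn deg.
have := @rat_unity_degree_bound _ t rat_edge k d.+1 x0 ut x0t.
have deg' x : x \in t -> (d.+1 <= count (rat_edge x) t)%N by move/deg; rewrite -ltnNge.
have eru (x y : C) : rat_edge x y -> rat_unity (y - x) by move/asboolP.
move=> /(_ eru (fun y x x' yt xt x't => nocol y x x' (tT y yt) (tT x xt) (tT x' x't)) deg').
move/ssrnat.leP/le_INR; rewrite INR_expn mult_INR INR_expn mult_INR.
(* Truncated subtraction agrees with the real one because [2 ^ k <= S d]. *)
rewrite minus_INR; last first.
  by apply/INR_le; rewrite INR_expn.
rewrite INR_expn -[INR 2]/2%coqR => le1.
apply: (Rlt_not_le _ _ lt).
apply: Rle_trans le1 _.
rewrite INR_expn (INR_IZR_INZ 4) -mul2n; apply: Rmult_le_compat_r.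
  apply/pow_le/Rmult_le_pos; first exact: pos_INR.
  by apply: pow_le => /=; lra.
by apply/le_INR/ssrnat.leP; rewrite uniq_leq_size.
Qed.

Lemma count_pairs_good_bound (n : nat) (S : list point) :
  Peano.le 2 n -> List.NoDup S -> length S = n -> no_three_collinear S ->
  (INR (count_pairs good_pair S) <= Rpower (INR n) (1 + 6 / sqrt (ln (INR n))))%coqR.
Proof.
move=> n2 ndS Dn nocol.
have n_gt1 : (1 < INR n)%coqR by have := le_INR _ _ n2; rewrite /=; lra.
have ln_gt0 : (0 < ln (INR n))%coqR by rewrite -ln_1; apply: ln_increasing; lra.
set L := sqrt (ln (INR n)); have L_gt0 : (0 < L)%coqR by apply: sqrt_lt_R0.
have LL : (L * L = ln (INR n))%coqR by apply: sqrt_sqrt; lra.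
have sz : size (map to_complex S) = n by rewrite size_map.
have le_e : (INR (count_pairs good_pair S) <= INR (npairs rat_edge (map to_complex S)))%coqR.
  by apply/le_INR/ssrnat.leP/count_pairs_le_npairs.
apply: Rle_trans le_e _.
(* As [ln n = L * L], the factor n^(6/L) is [exp (6 * L)]. *)
have -> : Rpower (INR n) (1 + 6 / L)%coqR = (INR n * exp (6 * L))%coqR.
  rewrite Rpower_plus Rpower_1; last by lra.
  by congr Rmult; rewrite /Rpower -LL; congr exp; field; lra.
case: (Rlt_le_dec 6 L) => [L6 | L6].
  rewrite -[in INR n]sz; apply: npairs_rat_edge_bound => //.
  - by rewrite sz LL exp_ln; lra.
  - by rewrite map_inj_uniq; [exact: NoDup_uniq | exact: to_complex_inj].
  - exact: no_three_collinear_complex.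
(* For [L <= 6] one has [n = exp (L * L) <= exp (6 * L)], so the trivial bound [n * n] suffices. *)
have le_sqr : (INR (npairs rat_edge (map to_complex S)) <= INR n * INR n)%coqR.
  by rewrite -mult_INR; apply/le_INR/ssrnat.leP; rewrite -[in X in (_ <= X)%N]sz npairs_le_sqr.
apply: Rle_trans le_sqr _; apply: Rmult_le_compat_l; first exact: pos_INR.
rewrite -[X in Rle X]exp_ln; last by lra.
by apply: Rexp_le; rewrite -LL; nra.
Qed.


End RootsOfUnity.

Theorem theorem2 (n : nat) (S : list point) :
  (2 <= n)%nat -> NoDup S -> length S = n -> no_three_collinear S ->
  INR (count_pairs good_pair S)
    <= Rpower (INR n) (1 + 6 / sqrt (ln (INR n))).
Proof. exact (@RootsOfUnity.count_pairs_good_bound n S). Qed.
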